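(* Let $(\delta,K_1,K_2,C_0,C_1,\mathcal S)$ be an antipodal sequence of admissible parameters and let $\Gamma$ be the Fraïssé limit of $\mathcal A^\delta_{K_1,K_2,C_0,C_1}\cap\mathcal A_{\mathcal S}$. Then: (1) if $K_1<\infty$ and $\delta$ is even, $\Gamma$ has a stationary independence relation; (2) if $K_1=\infty$ and $\delta$ is odd, $\Gamma$ has no stationary independence relation but has a local one; (3) if $K_1<\infty$ and $\delta$ is odd, $\Gamma$ has no local stationary independence relation; (4) if $K_1=\infty$ and $\delta$ is even, $\Gamma$ has no local stationary independence relation.
   Context: $\mathcal A^\delta_{K_1,K_2,C_0,C_1}$ is the class of finite metric spaces with integer distances in $\{1,\dots,\delta\}$ such that for every triangle with perimeter $p$ and shortest side $m$: if $p$ odd then $2K_1<p<2K_2+2m$ and $p<C_1$; if $p$ even then $p<C_0$. The parameters ($3\le\delta<\infty$) are antipodal admissible if either (I) $K_1=\infty$, $K_2=0$, $C_0=2\delta+2$, $C_1=2\delta+1$; or (IIA) $1\le K_1\le\delta/2$, $K_2=\delta-K_1$, $C_0=2\delta+2$, $C_1=2\delta+1$. A clique is a metric space with all distances $1$; an antipodal companion of a clique on $K$ is obtained by choosing $S\subseteq K$ and setting distances between $S$ and $K\setminus S$ to $\delta-1$. $\mathcal S$ is a set of cliques and antipodal companions of cliques, each with at least 4 points, containing no forbidden triangle, and if $K_1<\infty$ and $\mathcal S\neq\emptyset$ then $\delta\ge4$ and $\mathcal S$ consists of a clique and all its antipodal companions. $\mathcal A_{\mathcal S}$ is the class of finite metric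 spaces omitting all members of $\mathcal S$. A ternary relation $\perp$ on finite substructures of a homogeneous structure $\mathbf M$ is a stationary independence relation if it satisfies: Invariance (depends only on the type of $(\mathbf A,\mathbf B,\mathbf C)$); Symmetry ($\mathbf A\perp_{\mathbf C}\mathbf B\Rightarrow\mathbf B\perp_{\mathbf C}\mathbf A$); Monotonicity ($\mathbf A\perp_{\mathbf C}\langle\mathbf B\mathbf D\rangle\Rightarrow\mathbf A\perp_{\mathbf C}\mathbf B$ and $\mathbf A\perp_{\langle\mathbf B\mathbf C\rangle}\mathbf D$, where $\langle\cdot\rangle$ is the substructure on the union); Existence (for all $\mathbf A,\mathbf B,\mathbf C$ some $\mathbf A'$ of the same type as $\mathbf A$ over $\mathbf C$ has $\mathbf A'\perp_{\mathbf C}\mathbf B$); Stationarity (if $\mathbf A,\mathbf A'$ have the same type over $\mathbf C$ and both are independent from $\mathbf B$ over $\mathbf C$, they have the same type over $\langle\mathbf B\mathbf C\rangle$). It is local if defined only for nonempty $\mathbf C$. *)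

(* Defs.v *)
From HB Require Import structures.
From mathcomp Require Import all_boot finmap.

Set Implicit Arguments.
Unset Strict Implicit.
Unset Printing Implicit Defensive.

Definition is_metric (T : Type) (d : T -> T -> nat) : Prop :=
  [/\ forall x y, d x y = 0 <-> x = y,
      forall x y, d x y = d y x
    & forall x y z, d x z <= d x y + d y z].

Definition isometric_embedding (U V : Type) (dU : U -> U -> nat)
    (dV : V -> V -> nat) (f : U -> V) : Prop :=
  forall x y, dV (f x) (f y) = dU x y.

Record finMetric := FinMetric {
  points :> finType;
  dist : points -> points -> nat;
  distP : is_metric dist }.

Definition embeds (X Y : finMetric) : Prop :=
  exists f : X -> Y, isometric_embedding (@dist X) (@dist Y) f.

Definition isometric (X Y : finMetric) : Prop :=
  exists2 f : X -> Y,
    bijective f & isometric_embedding (@dist X) (@dist Y) f.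

(* The parameter K1 ranges over the naturals and infinity; None is infinity. *)
Definition twice_lt (K1 : option nat) (p : nat) : Prop :=
  if K1 is Some k then 2 * k < p else False.

Definition allowed_triangle (K1 : option nat) (K2 C0 C1 a b c : nat) : Prop :=
  let p := a + b + c in
  let m := minn a (minn b c) in
  if odd p then [/\ twice_lt K1 p, p < 2 * K2 + 2 * m & p < C1]
  else p < C0.

Definition no_forbidden_triangle (K1 : option nat) (K2 C0 C1 : nat)
    (X : finMetric) : Prop :=
  forall x y z : X, x <> y -> y <> z -> x <> z ->
    allowed_triangle K1 K2 C0 C1 (dist x y) (dist y z) (dist x z).

Definition class_A (delta : nat) (K1 : option nat) (K2 C0 C1 : nat)
    (X : finMetric) : Prop :=
  (forall x y : X, dist x y <= delta) /\ no_forbidden_triangle K1 K2 C0 C1 X.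

(* The two disjuncts are the bipartite case (I) and the case (IIA). *)
Definition antipodal_admissible (delta : nat) (K1 : option nat)
    (K2 C0 C1 : nat) : Prop :=
  3 <= delta /\
  ([/\ K1 = None, K2 = 0, C0 = 2 * delta + 2 & C1 = 2 * delta + 1] \/
   exists2 k : nat, K1 = Some k &
     [/\ 1 <= k, 2 * k <= delta, K2 = delta - k,
         C0 = 2 * delta + 2 & C1 = 2 * delta + 1]).

Definition is_clique (X : finMetric) : Prop :=
  forall x y : X, x <> y -> dist x y = 1.

(* X is, up to the bijection f, the clique K with the distances between A and
   its complement reset to delta - 1. *)
Definition antipodal_companion (delta : nat) (K X : finMetric) : Prop :=
  exists (A : {set K}) (f : K -> X), bijective f /\
    forall x y : K, dist (f x) (f y) =
      if (x \in A) == (y \in A) then dist x y else delta - 1.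

(* A set of finite metric spaces is a predicate, and is only used up to
   isometry: it need not be closed under isometry. *)
Definition consists_of_clique_and_companions (delta : nat)
    (Sc : finMetric -> Prop) : Prop :=
  exists K : finMetric, is_clique K /\
    let family X := isometric K X \/ antipodal_companion delta K X in
    (forall X, Sc X -> family X) /\
    (forall X, family X -> exists2 Y, Sc Y & isometric X Y).

Definition admissible_constraints (delta : nat) (K1 : option nat)
    (K2 C0 C1 : nat) (Sc : finMetric -> Prop) : Prop :=
  (forall X, Sc X ->
     [/\ is_clique X \/
           (exists K, is_clique K /\ antipodal_companion delta K X),
         4 <= #|X|
       & no_forbidden_triangle K1 K2 C0 C1 X]) /\
  (K1 <> None -> (exists X, Sc X) ->
     4 <= delta /\ consists_of_clique_and_companions delta Sc).

Definition omits (Sc : finMetric -> Prop) (X : finMetric) : Prop :=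
  forall Y, Sc Y -> ~ embeds Y X.

(* First-order formulas over the binary relations "at distance k"; the
   relation for k = 0 is equality. *)
Inductive formula : Type :=
  | Dist of nat & nat & nat
  | Bot
  | Imp of formula & formula
  | All of nat & formula.

Section Structure.
Variables (T : countType) (d : T -> T -> nat).
Implicit Types (A B C D X : {fset T}) (f g : T -> T).
Local Open Scope fset_scope.

Definition homogeneous : Prop :=
  forall A f, {in A &, forall x y, d (f x) (f y) = d x y} ->
  exists g, [/\ bijective g, isometric_embedding d d g & {in A, f =1 g}].

Definition fraisse_limit (K : finMetric -> Prop) : Prop :=
  [/\ is_metric d, homogeneous
    & forall X : finMetric,
        (exists h : X -> T, isometric_embedding (@dist X) d h) <-> K X].

Fixpoint sat (v : nat -> T) (phi : formula) : Prop :=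
  match phi with
  | Dist k i j => d (v i) (v j) = k
  | Bot => False
  | Imp p q => sat v p -> sat v q
  | All i p => forall x : T, sat (fun j => if j == i then x else v j) p
  end.

(* An enumeration of X and its image under f have the same complete type. *)
Definition same_type X f : Prop :=
  forall (phi : formula) (v : nat -> T), (forall i, v i \in X) ->
    (sat v phi <-> sat (f \o v) phi).

(* An enumeration of A and its image under f have the same type over C. *)
Definition same_type_over C A f : Prop :=
  {in C, forall x, f x = x} /\ same_type (A `|` C) f.

(* indep A C B stands for "A is independent from B over C"; dom C says that
   the base C is one over which independence is defined. *)
Section SIR.
Variables (dom : {fset T} -> Prop)
          (indep : {fset T} -> {fset T} -> {fset T} -> Prop).

Definition sir_invariance : Prop :=
  forall A B C f, dom C -> same_type (A `|` B `|` C) f ->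
    (indep A C B <-> indep (f @` A) (f @` C) (f @` B)).

Definition sir_symmetry : Prop :=
  forall A B C, dom C -> indep A C B -> indep B C A.

Definition sir_monotonicity : Prop :=
  forall A B C D, dom C -> indep A C (B `|` D) ->
    indep A C B /\ indep A (B `|` C) D.

Definition sir_existence : Prop :=
  forall A B C, dom C ->
    exists2 f, same_type_over C A f & indep (f @` A) C B.

Definition sir_stationarity : Prop :=
  forall A B C f, dom C -> same_type_over C A f ->
    indep A C B -> indep (f @` A) C B ->
    exists2 g, {in A, g =1 f} & same_type_over (B `|` C) A g.

Definition sir_axioms : Prop :=
  [/\ sir_invariance, sir_symmetry, sir_monotonicity,
      sir_existence & sir_stationarity].

End SIR.

Definition has_sir : Prop :=
  exists indep, sir_axioms (fun _ => True) indep.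

Definition has_local_sir : Prop :=
  exists indep, sir_axioms (fun C => C <> fset0) indep.

End Structure.

(* Main.v *)
Require Import Defs.
From HB Require Import structures.
From mathcomp Require Import all_boot finmap zify.
Set Implicit Arguments.
Unset Strict Implicit.
Unset Printing Implicit Defensive.

(** All perimeters are at most 2 delta, so d a c and d b c confine d a b to the interval
    from |d a c - d b c| to min (d a c + d b c, 2 delta - d a c - d b c). When a
    distance delta / 2 is available (delta even and K1 finite), or when exactly
    one of the two middle values has the parity forced by a nonempty base
    (K1 infinite and delta odd), declare a and b independent over C if d a b is
    the point closest to the middle of the intersection of these intervals over
    c in C; triangles completed in this way are allowed because an odd triangle
    is always glued from two triangles one of which is odd.

    Conversely, an independence relation gives the same distance from a to b and
    to b' whenever an isometry preserving the base C and the type of a over C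
    takes b to b'. This is violated over the empty base by adjacent b and b'
    in the bipartite case, and over a pair c1, c2 at distance delta - 2 by the
    antipodes b and b', where d b c1 = 1, d b c2 = delta - 1 and a is at distance
    floor (delta / 2) from both c1 and c2: then d a b = delta - d a b, against
    parity. *)

(** * Arithmetic of allowed triangles *)

Definition tri_ok (K1 : option nat) (delta x y z : nat) : Prop :=
  [/\ x <= y + z, y <= x + z, z <= x + y, x + y + z <= 2 * delta
    & odd (x + y + z) -> if K1 is Some k then
        [/\ 2 * k < x + y + z, x + y + z < 2 * (delta - k) + 2 * x,
            x + y + z < 2 * (delta - k) + 2 * y
          & x + y + z < 2 * (delta - k) + 2 * z] else False].

Definition mid (delta z : nat) : Prop := delta./2 <= z <= delta - delta./2.

(* z lies outside the middle range and is the bound nearest to the middle that a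
   base point at distances x and y from the two points imposes on their
   distance. *)
Definition edge (delta x y z : nat) : Prop :=
  (z < delta./2 /\ (z = x + y \/ z + x + y = 2 * delta)) \/
  (delta - delta./2 < z /\ (x = z + y \/ y = z + x)).

Definition half_bounded (K1 : option nat) (delta : nat) : Prop :=
  if K1 is Some k then 2 * k <= delta else True.

(* With a base point c, the triangle with sides w, z, z' is cut into the triangles
   w, x, x' and x, y, z by the segments from c to its vertices, and z' is a side
   of the degenerate triangle x', y, z'. *)
Lemma tri_ok_glue K1 delta w x x' y z z' :
  half_bounded K1 delta ->
  tri_ok K1 delta w x x' -> tri_ok K1 delta x y z -> edge delta x' y z' ->
  w <= z + z' -> z <= w + z' -> z' <= w + z -> w + z + z' <= 2 * delta ->
  tri_ok K1 delta w z z'.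
Proof.
move=> hk [h1 h2 h3 h4 h5] [g1 g2 g3 g4 g5] he i1 i2 i3 i4; split=> // ho.
(* Since [x' + y + z'] is even by [edge], the two pieces and the glued triangle have perimeters with
   even sum. *)
have hor : odd (w + x + x') \/ odd (x + y + z).
  by case: he => [[_ [E|E]]|[_ [E|E]]]; lia.
case: K1 hk h5 g5 => [k|] hk h5 g5; last by case: hor.
rewrite /half_bounded in hk.
case: hor => [/h5|/g5] [j1 j2 j3 j4];
 case: he => [[he [E|E]]|[he [E|E]]]; split; lia.
Qed.

Lemma tri_ok_swap12 K1 delta x y z : tri_ok K1 delta x y z -> tri_ok K1 delta y x z.
Proof.
move=> [h1 h2 h3 h4 h5]; split; [lia|lia|lia|lia|].
rewrite (addnC y x) => /h5; case: K1 {h5} => // k [] *; split; lia.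
Qed.

Lemma tri_ok_swap23 K1 delta x y z : tri_ok K1 delta x y z -> tri_ok K1 delta x z y.
Proof.
move=> [h1 h2 h3 h4 h5]; split; [lia|lia|lia|lia|].
rewrite addnAC => /h5; case: K1 {h5} => // k [] *; split; lia.
Qed.

(* The cases in which the middle range singles out one distance, in the second
   case once its parity is known. *)
Definition tame (K1 : option nat) (delta : nat) : Prop :=
  if K1 is Some k then 2 * k <= delta /\ ~~ odd delta else odd delta.

Lemma tame_half_bounded K1 delta : tame K1 delta -> half_bounded K1 delta.
Proof. by case: K1 => // k []. Qed.

(** For finite [K1] both [z] and [z'] equal [delta / 2], and an odd [w] is less than the even
    [delta]. For infinite [K1], parity decides: if [z = z'] then [w] is even, hence at most
    [delta - 1]; otherwise [w] is odd, hence positive. *)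
Lemma tri_ok_mid K1 delta w z z' :
  tame K1 delta -> (K1 = None -> ~~ odd (w + z + z')) -> w <= delta ->
  mid delta z -> mid delta z' -> tri_ok K1 delta w z z'.
Proof.
rewrite /mid; case: K1 => [k [hk he] _|ho /(_ erefl) hp] hw hz hz'.
  by split; [lia|lia|lia|lia|] => ho; split; lia.
rewrite /tame in ho.
by split; [lia|lia|lia|lia|]; rewrite (negbTE hp).
Qed.

Lemma tri_ok_edge_mid K1 delta w x x' y z z' :
  half_bounded K1 delta -> w <= delta ->
  tri_ok K1 delta w x x' -> tri_ok K1 delta x y z ->
  mid delta z -> edge delta x' y z' -> tri_ok K1 delta w z z'.
Proof.
move=> hk hw t1 t2 hz he; apply: (tri_ok_glue hk t1 t2 he);
  case: t1 t2 => [h1 h2 h3 h4 _] [g1 g2 g3 g4 _];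
  move: hz; rewrite /mid; case: he => [[he [E|E]]|[he [E|E]]]; lia.
Qed.

(** The base points that determine [z] and [z'] may differ: the one for [z'] allows the gluing, and
    the one for [z] bounds [z'] in terms of [w] and [z]. *)
Lemma tri_ok_edge_edge K1 delta w x x' y z z' x1 x1' y1 :
  half_bounded K1 delta -> w <= delta ->
  tri_ok K1 delta w x x' -> tri_ok K1 delta x y z -> edge delta x' y z' ->
  tri_ok K1 delta w x1 x1' -> tri_ok K1 delta x1' y1 z' -> edge delta x1 y1 z ->
  tri_ok K1 delta w z z'.
Proof.
move=> hk hw t1 t2 he s1 s2 he1; apply: (tri_ok_glue hk t1 t2 he);
  case: t1 t2 s1 s2 => [h1 h2 h3 h4 _] [g1 g2 g3 g4 _];
  move=> [i1 i2 i3 i4 _] [j1 j2 j3 j4 _];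
  case: he => [[he [E|E]]|[he [E|E]]];
  case: he1 => [[he1 [E1|E1]]|[he1 [E1|E1]]]; lia.
Qed.

(** * Canonical distances over a base *)

Section Canonical.
Variables (K1 : option nat) (delta : nat) (T : countType) (d : T -> T -> nat).
Hypothesis (dxx : forall x, d x x = 0) (dC : forall x y, d x y = d y x).
Hypothesis tri : forall x y z, tri_ok K1 delta (d x y) (d x z) (d y z).
Implicit Types (C : {fset T}) (a b c : T).

(** That [z] lies in all the intervals is left out: it is automatic for actual distances and assumed
    separately, through [tri_ok], for new ones. *)
Definition canon C a b z : Prop :=
  mid delta z \/ exists2 c, c \in C & edge delta (d a c) (d b c) z.

Lemma dist_le_delta x y : d x y <= delta.
Proof. by have [] := tri x y y; rewrite dxx; lia. Qed.

Lemma edgeC x y z : edge delta x y z -> edge delta y x z.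
Proof. by rewrite /edge; lia. Qed.

Lemma canonC C a b z : canon C a b z -> canon C b a z.
Proof. by case=> [h|[c hc /edgeC h]]; [left|right; exists c]. Qed.

Lemma canon_tri C a a' b z z' : tame K1 delta ->
  (K1 = None -> exists c, c \in C) ->
  canon C a b z -> (forall c, c \in C -> tri_ok K1 delta (d a c) (d b c) z) ->
  canon C a' b z' -> (forall c, c \in C -> tri_ok K1 delta (d a' c) (d b c) z') ->
  tri_ok K1 delta (d a a') z z'.
Proof.
move=> ht hC hz tz hz' tz'.
have hk := tame_half_bounded ht; have hw := dist_le_delta a a'.
case: hz => [hz|[c hc hz]]; case: hz' => [hz'|[c' hc' hz']].
(* The parity of [d a a' + z + z'] follows from three even triangles at [c]. *)
- apply: tri_ok_mid => // K0; case: (hC K0) => c hc.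
  case: (tz c hc) (tz' c hc) (tri a a' c); rewrite K0.
  by move=> _ _ _ _ h1 [_ _ _ _ h2] [_ _ _ _ h3]; lia.
- exact: tri_ok_edge_mid (tri a a' c') (tz c' hc') hz hz'.
- apply: tri_ok_swap23; apply: tri_ok_edge_mid (tz' c hc) hz' hz => //.
  by rewrite dC; apply: tri.
- exact: tri_ok_edge_edge (tri a a' c') (tz c' hc') hz'
    (tri a a' c) (tz' c hc) hz.
Qed.

(** The intervals from [lo c] to [up c] meet pairwise, so the point nearest to the middle is the
    largest [lo], the smallest [up] or a middle value. In the first two cases, gluing along the base
    point that attains the bound gives allowed triangles. *)
Lemma canon_ex C a b : tame K1 delta -> (K1 = None -> exists c, c \in C) ->
  exists2 z, canon C a b z &
    forall c, c \in C -> tri_ok K1 delta (d a c) (d b c) z.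
Proof.
move=> ht hC; have hk := tame_half_bounded ht.
have bd x y := dist_le_delta x y.
pose lo c := (d a c - d b c) + (d b c - d a c).
pose up c := minn (d a c + d b c) (2 * delta - (d a c + d b c)).
have glue c0 z : c0 \in C -> edge delta (d a c0) (d b c0) z ->
    (forall c, c \in C -> lo c <= z <= up c) ->
    exists2 z, canon C a b z &
    forall c, c \in C -> tri_ok K1 delta (d a c) (d b c) z.
  move=> hc0 he hz; exists z; first by right; exists c0.
  move=> c hc; have := hz c hc; rewrite /lo /up => hl.
  have b1 := bd a c; have b2 := bd b c.
  apply: (@tri_ok_glue _ _ _ (d c c0) (d a c0) (d b c0)) => //; try lia.
  - exact: tri_ok_swap23 (tri a c c0).
  - exact: tri_ok_swap12 (tri_ok_swap23 (tri_ok_swap12 (tri b c c0))).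
have lu c c' : lo c <= up c'.
  have [i1 i2 i3 i4 _] := tri a c c'; have [j1 j2 j3 j4 _] := tri b c c'.
  by rewrite /lo /up; have := bd a c'; have := bd b c'; lia.
have [/existsP[c1 h1]|/existsPn hlo] :=
  boolP [exists c : C, delta - delta./2 < lo (val c)].
  case: (@arg_maxnP _ c1 xpredT (fun c : C => lo (val c)) isT) => c0 _ hmax.
  apply: (glue (val c0) (lo (val c0)) (valP c0)).
    have h0 : lo (val c1) <= lo (val c0) := hmax c1 isT.
    by right; move: (leq_trans h1 h0); rewrite /lo; lia.
  move=> c hc; rewrite lu andbT; exact: (hmax [` hc]%fset isT).
have [/existsP[c1 h1]|/existsPn hup] :=
  boolP [exists c : C, up (val c) < delta./2].
  case: (@arg_minnP _ c1 xpredT (fun c : C => up (val c)) isT) => c0 _ hmin.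
  apply: (glue (val c0) (up (val c0)) (valP c0)).
    have h0 : up (val c0) <= up (val c1) := hmin c1 isT.
    left; move: (leq_ltn_trans h0 h1); rewrite /up.
    by have := bd a (val c0); have := bd b (val c0); lia.
  move=> c hc; rewrite lu /=; exact: (hmin [` hc]%fset isT).
have hm c : c \in C -> lo c <= delta - delta./2 /\ delta./2 <= up c.
  by move=> hc; have := hlo [` hc]%fset; have := hup [` hc]%fset => /=; lia.
case EK : K1 => [k|].
  rewrite EK /= in ht; case: ht => hk' he.
  exists delta./2; first by left; rewrite /mid; lia.
  move=> c hc; have := hm c hc; rewrite /lo /up => hl.
  have b1 := bd a c; have b2 := bd b c.
  by split; [lia|lia|lia|lia|] => ho; split; lia.
rewrite EK /= in ht; case: (hC EK) => c1 hc1.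
(* The correction by 0 or 1 gives the middle value of the parity that [c1] forces. *)
exists (delta./2 + odd (d a c1 + d b c1 + delta./2)).
  by left; rewrite /mid; lia.
move=> c hc; have := hm c hc; rewrite /lo /up => hl.
have b1 := bd a c; have b2 := bd b c.
have [_ _ _ _ p1] := tri a c c1; have [_ _ _ _ p2] := tri b c c1.
rewrite EK in p1 p2.
by split; lia.
Qed.

End Canonical.

(** * Types and automorphisms of homogeneous structures *)

Section Homogeneous.
Variables (T : countType) (d : T -> T -> nat).
Hypothesis (metr : is_metric d) (hom : homogeneous d).
Implicit Types (A B C X : {fset T}) (f g : T -> T).
Local Open Scope fset_scope.

(** Homogeneity for indexed families, possibly with repetitions: the map is well defined because
    distance 0 is equality. *)
Lemma family_extension (I : finType) (u v : I -> T) :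
  (forall i j, d (u i) (u j) = d (v i) (v j)) ->
  exists g, [/\ bijective g, isometric_embedding d d g & forall i, g (u i) = v i].
Proof.
move=> uv; case: metr => d0 _ _.
pose f x := if [pick i | u i == x] is Some i then v i else x.
have fu i : f (u i) = v i.
  rewrite /f; case: pickP => [j /eqP e|/(_ i)]; last by rewrite eqxx.
  by apply/d0; rewrite -uv e; apply/d0.
have fA : {in [fset u i | i : I] &, forall x y, d (f x) (f y) = d x y}.
  by move=> _ _ /imfsetP[i _ ->] /imfsetP[j _ ->]; rewrite !fu uv.
have [g [bg ig fg]] := hom fA; exists g; split=> // i.
by rewrite -fg ?fu //; apply/imfsetP; exists i.
Qed.

Lemma sat_eq phi v v' : v =1 v' -> sat d v phi <-> sat d v' phi.
Proof.
elim: phi v v' => [k i j|//|p IHp q IHq|i p IHp] v v' e //=.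
- by rewrite !e.
- by rewrite (IHp _ _ e) (IHq _ _ e).
- have IH x : sat d (fun j => if j == i then x else v j) p <->
              sat d (fun j => if j == i then x else v' j) p.
    by apply: IHp => j; case: ifP.
  by split=> h x; apply/IH.
Qed.

Lemma sat_automorphism g phi v : bijective g -> isometric_embedding d d g ->
  sat d v phi <-> sat d (g \o v) phi.
Proof.
move=> bg ig; elim: phi v => [k i j|//|p IHp q IHq|i p IHp] v /=.
- by rewrite ig.
- by rewrite IHp IHq.
- case: bg => g' gK g'K.
  have IH x : sat d (fun j => if j == i then x else v j) p <->
              sat d (fun j => if j == i then g x else (g \o v) j) p.
    by rewrite IHp; apply: sat_eq => j /=; case: ifP.
  split=> h x; last by apply/IH.
  by rewrite -(g'K x); apply/IH.
Qed.

(** Atomic formulas already record the distances; conversely, homogeneity extends an isometry to an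
    automorphism, which preserves every formula. *)
Lemma same_type_isometry X f :
  same_type d X f <-> {in X &, forall x y, d (f x) (f y) = d x y}.
Proof.
split=> [h x y hx hy|h phi v hv].
  have [hd _] := h (Dist (d x y) 0 1) (fun i => if i is 0 then x else y)
    (fun i => match i with 0 => hx | _ => hy end).
  exact: hd.
have [g [bg ig fg]] := hom h.
rewrite (sat_automorphism phi v bg ig); apply: sat_eq => i /=.
by rewrite fg.
Qed.

(** * An obstruction to independence *)

Section NoSIR.
Variables (dom : {fset T} -> Prop)
          (indep : {fset T} -> {fset T} -> {fset T} -> Prop).

(** Take [a'] of the type of [a] over [C], independent from [b] and [b']. By invariance [r a'] is
    independent from [r b = b'], so stationarity gives [a'] and [r a'] the same distance to [b'];
    the latter is [d a' b]. *)
Lemma sir_equidistant C a b b' r : sir_axioms d dom indep -> dom C ->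
  isometric_embedding d d r -> r @` C = C -> r b = b' ->
  (forall a', {in C, forall c, d a' c = d a c} ->
     {in C, forall c, d (r a') c = d a' c}) ->
  exists2 a', {in C, forall c, d a' c = d a c} & d a' b = d a' b'.
Proof.
case=> inv sym mono ex stat hC ir rC rb ra.
have [d0 dC _] := metr.
have [f [fC /same_type_isometry fA] hf] := ex [fset a] [fset b; b'] C hC.
have a'E : {in C, forall c, d (f a) c = d a c}.
  move=> c hc; rewrite -{1}(fC c hc) fA ?inE ?eqxx ?hc ?orbT //.
rewrite imfset_fset1 in hf; move: a'E hf; move: (f a) => a' a'E hf {f fC fA}.
have [ib _] := mono _ _ _ _ hC hf.
rewrite fsetUC in hf; have [ib' _] := mono _ _ _ _ hC hf.
exists a' => //.
have [] := inv [fset a'] [fset b] C r hC.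
  by apply/same_type_isometry => x y _ _; apply: ir.
rewrite rC !imfset_fset1 rb => /(_ ib) irb _.
pose h x := if x == a' then r a' else x.
have hcC : {in C, forall c, h c = c}.
  move=> c hc; rewrite /h; case: eqP => // e; subst c.
  by apply/d0; rewrite ra //; apply/d0.
have hA : same_type_over d C [fset a'] h.
  split=> //; apply/same_type_isometry => x y.
  rewrite !inE => /orP[/eqP->|hx] /orP[/eqP->|hy].
  - by rewrite /h eqxx; apply: ir.
  - by rewrite (hcC y hy) /h eqxx ra.
  - by rewrite (hcC x hx) /h eqxx dC ra // dC.
  - by rewrite !hcC.
have [|g gA [gB /same_type_isometry gi]] := stat _ _ _ _ hC hA ib'.
  by rewrite imfset_fset1 /h eqxx.
have := gi a' b'; rewrite !inE !eqxx /= !orbT => /(_ isT isT).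
rewrite (gA a') ?inE // (gB b') ?inE ?eqxx // /h eqxx => <-.
by rewrite -rb ir.
Qed.

End NoSIR.
End Homogeneous.

(** * Triangles, constraints and one-point extensions in the limit *)

Section Age.
Variables (delta : nat) (K1 : option nat) (K2 C0 C1 : nat).
Variables (Sc : finMetric -> Prop) (T : countType) (d : T -> T -> nat).
Hypothesis (hpar : antipodal_admissible delta K1 K2 C0 C1).
Hypothesis (hSc : admissible_constraints delta K1 K2 C0 C1 Sc).
Hypothesis (hlim : fraisse_limit d
              (fun X => class_A delta K1 K2 C0 C1 X /\ omits Sc X)).
Local Open Scope fset_scope.
Implicit Types (A B C F : {fset T}).

Lemma limit_metric : is_metric d. Proof. by case: hlim. Qed.
Lemma limit_homogeneous : homogeneous d. Proof. by case: hlim. Qed.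

Lemma limit_dxx x : d x x = 0. Proof. by case: limit_metric => h _ _; apply/h. Qed.
Lemma limit_dC x y : d x y = d y x. Proof. by case: limit_metric. Qed.
Lemma limit_d0 x y : d x y = 0 -> x = y.
Proof. by case: limit_metric => h _ _ /h. Qed.

Lemma admissible_half_bounded : half_bounded K1 delta.
Proof. by case: hpar => _ [[-> //]|[k -> []]]. Qed.

(** The bounds [C0] and [C1], one for each parity, both amount to perimeter at most [2 * delta]. *)
Lemma allowed_tri_ok x y z : x <= y + z -> y <= x + z -> z <= x + y ->
  allowed_triangle K1 K2 C0 C1 x y z <-> tri_ok K1 delta x y z.
Proof.
move=> h1 h2 h3; rewrite /allowed_triangle /tri_ok.
case: hpar => _ [[-> -> -> ->]|[k -> [k1 k2 -> -> ->]]]; case: ifP => ho.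
- by split=> [[]//|[_ _ _ _ /(_ isT)]].
- by split=> [h|[]]; [split=> //|]; lia.
- rewrite /twice_lt; split=> [[i1 i2 i3]|[_ _ _ i0 /(_ isT)[i1 i2 i3 i4]]].
    by split=> //; [lia|] => _; split; lia.
  by split; lia.
- by split=> [h|[]]; [split=> //|]; lia.
Qed.

Lemma fset_metric F : is_metric (fun x y : F => d (fsval x) (fsval y)).
Proof.
case: limit_metric => d0 ds dt; split=> // x y; split=> [e|->].
  by apply: val_inj; apply: limit_d0.
exact: limit_dxx.
Qed.

Lemma limit_tri x y z : tri_ok K1 delta (d x y) (d x z) (d y z).
Proof.
case: hlim => -[d0 ds dt] _ age.
have [/(_ (ex_intro _ (fun u => fsval u) (fun _ _ => erefl))) [[bd nf] _] _] :=
  age (FinMetric (fset_metric [fset x; y; z])).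
have hx : x \in [fset x; y; z] by rewrite !inE eqxx.
have hy : y \in [fset x; y; z] by rewrite !inE eqxx orbT.
have hz : z \in [fset x; y; z] by rewrite !inE eqxx orbT.
have bxy := bd [` hx] [` hy]; have bxz := bd [` hx] [` hz].
rewrite /= in bxy bxz.
have t1 := dt x z y; have t2 := dt x y z; have t3 := dt y x z.
rewrite (ds z y) in t1; rewrite (ds y x) in t3.
have [e|/eqP nxy] := eqVneq x y.
  by subst y; rewrite limit_dxx; split; lia.
have [e|/eqP nyz] := eqVneq y z.
  by subst z; rewrite limit_dxx; split; lia.
have [e|/eqP nxz] := eqVneq x z.
  by subst z; rewrite limit_dxx (ds y x); split; lia.
apply: tri_ok_swap23; apply/allowed_tri_ok; try lia.
by apply: (nf [` hx] [` hy] [` hz]); move=> /(congr1 val).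
Qed.

Lemma limit_le x y : d x y <= delta.
Proof. exact: dist_le_delta limit_dxx limit_tri x y. Qed.

Lemma constraint_dist X : Sc X -> forall x y : X, x <> y ->
  dist x y = 1 \/ dist x y = delta - 1.
Proof.
case: hSc => h _ /h[[hc _ _ x y /hc|[K [hK [A [f [[g gK fK] hf]]]]] _ _ x y nxy]].
  by left.
rewrite -(fK x) -(fK y) hf; case: ifP => _; last by right.
by left; apply: hK => e; apply: nxy; rewrite -(fK x) -(fK y) e.
Qed.

(** Three points of a constraint span a triangle of odd perimeter 3 or [2 * delta - 1], which is
    forbidden when [K1] is infinite. *)
Lemma constraint_finite X : Sc X -> K1 <> None.
Proof.
move=> hX K0; case: hSc => h _; case: (h X hX) => hc h4 nf {h}.
have odd3 : exists x y z : X, [/\ x <> y, y <> z, x <> z &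
    odd (dist x y + dist y z + dist x z)].
  have d3 : 3 <= delta by case: hpar.
  case: hc => [hc|[K [hK [A [f [[g gK fK] hf]]]]]].
    have : 2 < #|X| by apply: leq_trans h4.
    case/card_gt2P=> x [y [z [_ [/eqP nxy /eqP nyz /eqP nzx]]]].
    by exists x, y, z; rewrite !hc //; try split=> //; move=> e; apply: nzx.
  have : 2 < #|K|.
    apply: leq_trans (_ : #|X| <= _); first exact: leq_trans h4.
    exact: (leq_card g (can_inj fK)).
  case/card_gt2P=> x [y [z [_ [/eqP nxy /eqP nyz /eqP nzx]]]].
  have nxz : x <> z by move=> e; apply: nzx.
  exists (f x), (f y), (f z); split; try by move/(can_inj gK).
  rewrite !hf !hK //.
  by case: (x \in A); case: (y \in A); case: (z \in A) => //=; lia.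
case: odd3 => x [y [z [nxy nyz nxz ho]]].
by have := nf x y z nxy nyz nxz; rewrite /allowed_triangle ho K0 => -[].
Qed.

(** [F] with a new point at distances [t] belongs to the age: a constraint using the new point would
    have a copy in the limit using [p0] instead. *)
Lemma one_point_extension F (t : F -> nat) :
  (forall x y : F, tri_ok K1 delta (t x) (t y) (d (fsval x) (fsval y))) ->
  (forall X, Sc X -> 2 < #|` F| -> exists p0, forall x : F,
     t x = 1 \/ t x = delta - 1 -> d p0 (fsval x) = t x) ->
  exists p, forall x : F, d p (fsval x) = t x.
Proof.
move=> ht hS; have [d0 ds dt] := limit_metric.
have [/existsP[x /eqP tx]|/existsPn tn] := boolP [exists x : F, t x == 0].
  exists (fsval x) => y; have [h1 h2 h3 h4 _] := ht x y; lia.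
have tp x : 0 < t x by rewrite lt0n tn.
pose e (u v : option F) := match u, v with
  | Some x, Some y => d (fsval x) (fsval y)
  | Some x, None => t x | None, Some x => t x | None, None => 0 end.
have em : is_metric e.
  split.
  - move=> [x|] [y|] //=; last 2 first.
    + by split=> // h; have := tp x; rewrite h.
    + by split=> // h; have := tp y; rewrite h.
    + by split=> [/d0/val_inj->//|[->]]; apply: limit_dxx.
  - by move=> [x|] [y|] //=; rewrite ds.
  - move=> [x|] [y|] [z|] //=; rewrite ?addn0 ?add0n //; try exact: dt.
    + by have [+ _ _ _ _] := ht x y; rewrite addnC.
    + by have [] := ht x z.
    + by have [_ + _ _ _] := ht y z; rewrite addnC.
have eok (u v w : option F) : u <> v -> v <> w -> u <> w ->
    tri_ok K1 delta (e u v) (e v w) (e u w).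
  case: u v w => [x|] [y|] [z|] n1 n2 n3 /=;
    try by [case: n1 | case: n2 | case: n3].
  - exact: tri_ok_swap23 (limit_tri _ _ _).
  - exact: tri_ok_swap12 (tri_ok_swap23 (tri_ok_swap12 (ht x y))).
  - exact: ht.
  - exact: tri_ok_swap23 (ht _ _).
have [_ _ age] := hlim.
have [_ []] := age (FinMetric em).
  split.
    split=> [[x|] [y|] //=|u v w nuv nvw nuw]; try exact: limit_le.
    - by have [] := ht x x; rewrite limit_dxx; lia.
    - by have [] := ht y y; rewrite limit_dxx; lia.
    have [_ _ et] := em; have [_ es _] := em.
    apply/allowed_tri_ok; last exact: eok.
    - by have := et u w v; rewrite (es w v) addnC.
    - by have := et v u w; rewrite (es v u).
    - exact: et.
  move=> Y hY [phi iphi].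
  have phi_inj : injective phi.
    move=> y y' eyy; apply/(let: And3 h _ _ := distP Y in h y y').
    by rewrite -iphi eyy; case: (phi y') => [z|] //=; apply: limit_dxx.
  have hc : 2 < #|` F|.
    have [_ h4 _] := (let: conj h _ := hSc in h Y hY).
    by have := leq_card phi phi_inj; rewrite card_option -cardfE; lia.
  (* All distances in Y are 1 or delta - 1, so p0 can replace the new point. *)
  have [p0 hp0] := hS Y hY hc.
  pose psi y := if phi y is Some x then fsval x else p0.
  have ipsi : isometric_embedding (@dist Y) d psi.
    have key y y' x : phi y = Some x -> phi y' = None -> d p0 (fsval x) = dist y y'.
      move=> hy hy'; have txy : dist y y' = t x by rewrite -iphi hy hy'.
      rewrite txy; apply: hp0; rewrite -txy; apply: constraint_dist => // eyy.
      by rewrite eyy hy' in hy.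
    move=> y y'; rewrite /psi.
    case hy : (phi y) => [x|]; case hy' : (phi y') => [x'|].
    - by rewrite -iphi hy hy'.
    - by rewrite limit_dC (key _ _ _ hy hy').
    - by rewrite (key _ _ _ hy' hy); case: (distP Y).
    - by rewrite -iphi hy hy' limit_dxx.
  have [/(_ (ex_intro _ psi ipsi)) [_ oY] _] := age Y.
  by apply: (oY Y hY); exists id.
move=> h ih.
(* An automorphism carries the embedded copy of [F] back onto [F]. *)
have [|g [_ ig gh]] := family_extension limit_metric limit_homogeneous
  (u := fun x : F => h (Some x)) (v := fun x : F => fsval x).
  by move=> x y; rewrite ih.
by exists (g (h None)) => x; rewrite -(gh x) ig ih.
Qed.

(** * The canonical independence relation *)

Lemma canon_base C a b c : c \in C -> d a c = 0 \/ d a c = delta ->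
  canon delta d C a b (d a b).
Proof.
move=> hc hac; have [h1 h2 h3 h4 _] := limit_tri a b c.
have [hm|hm] := boolP (delta./2 <= d a b <= delta - delta./2); first by left.
by right; exists c => //; rewrite /edge; lia.
Qed.

Lemma one_point_indep C E B a : tame K1 delta ->
  (K1 = None -> exists c, c \in C) -> C `<=` E ->
  {in E & B, forall x b, canon delta d C x b (d x b)} ->
  exists2 p, {in E, forall x, d p x = d a x} &
    {in B, forall b, canon delta d C p b (d p b)}.
Proof.
move=> ht hC /fsubsetP sCE hEB; have d3 : 3 <= delta by case: hpar.
have [/existsP[c hc]|/existsPn hc] :=
  boolP [exists c : C, (d a (fsval c) == 0) || (d a (fsval c) == delta)].
  exists a => // b _; apply: canon_base (valP c) _.
  by case/orP: hc => /eqP; [left|right].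
have ac c : c \in C -> 0 < d a c < delta.
  by move=> h; have := hc [` h]; have := limit_le a c => /=; lia.
pose P (x : E `|` B) z := if fsval x \in E then z = d a (fsval x) else
    canon delta d C a (fsval x) z /\
    forall c, c \in C -> tri_ok K1 delta (d a c) (d (fsval x) c) z.
have [|t tE] := @fin_all_exists (E `|` B) (fun => nat) P.
  move=> x; rewrite /P; case: (fsval x \in E); first by exists (d a (fsval x)).
  have [z] := canon_ex limit_dxx limit_tri a (fsval x) ht hC; by exists z.
rewrite /P in tE.
have inB (x : E `|` B) : fsval x \notin E -> fsval x \in B.
  by have := fsvalP x; rewrite inE => /orP[->|].
have tri' x y c : tri_ok K1 delta (d x c) (d y c) (d x y).
  exact: tri_ok_swap23 (tri_ok_swap12 (limit_tri x y c)).
have triC := canon_tri limit_dxx limit_dC limit_tri ht hC.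
have mixed (x y : E `|` B) : fsval x \in E -> fsval y \notin E ->
    tri_ok K1 delta (t x) (t y) (d (fsval x) (fsval y)).
  move=> hx hy; have := tE x; have := tE y; rewrite hx (negbTE hy).
  move=> [cy ty] ->; apply: (triC _ _ _ _ _ cy ty) => //.
  by apply: hEB => //; apply: inB.
have [|X hX _|p hp] := @one_point_extension (E `|` B) t.
- move=> x y; have [hx|hx] := boolP (fsval x \in E);
    have [hy|hy] := boolP (fsval y \in E).
  + have := tE x; have := tE y; rewrite hx hy => -> ->; exact: limit_tri.
  + exact: mixed.
  + by apply: tri_ok_swap12; rewrite limit_dC; apply: mixed.
  + have := tE x; have := tE y; rewrite (negbTE hx) (negbTE hy).
    move=> [cy ty] [cx tx]; apply: tri_ok_swap23; apply: tri_ok_swap12.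
    apply: (triC _ _ a); try exact: canonC.
      by move=> c hc'; apply: tri_ok_swap12; apply: tx.
    by move=> c hc'; apply: tri_ok_swap12; apply: ty.
- have K0 := constraint_finite hX; exists a => x tx.
  have := tE x; case: ifP => [//|hx [cx _]].
  have ev : ~~ odd delta by move: ht K0; case: (K1) => [k []|].
  case: cx => [|[c hcC]]; first by rewrite /mid; lia.
  have := ac c hcC; have [h1 h2 h3 h4 _] := limit_tri a (fsval x) c.
  have := limit_le (fsval x) c.
  have [xc|xc] := eqVneq (d (fsval x) c) 0.
    by rewrite (limit_d0 xc) (sCE c hcC) in hx.
  by rewrite /edge; lia.
have hpE : {in E, forall x, d p x = d a x}.
  move=> x hx; have hx' : x \in E `|` B by rewrite inE hx.
  by have := tE [` hx']; rewrite /= hx => <-; exact: (hp [` hx']).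
exists p => // b hb; have [hE|hE] := boolP (b \in E).
  apply: canonC; rewrite limit_dC.
  case: (hEB b b hE hb) => [|[c hcC]]; rewrite limit_dxx; first by rewrite /mid; lia.
  move=> he; apply: (canon_base _ hcC); have := limit_le b c.
  by move: he; rewrite /edge; lia.
have hb' : b \in E `|` B by rewrite inE hb orbT.
have := tE [` hb']; rewrite /= (negbTE hE) => -[cb _].
have -> : d p b = t [` hb'] := hp [` hb'].
case: cb => [|[c hcC he]]; first by left.
by right; exists c => //; rewrite hpE ?sCE.
Qed.

Definition canonical_indep A C B : Prop :=
  {in A & B, forall a b, canon delta d C a b (d a b)}.

Lemma canonical_indep_ex C B (s : seq T) : tame K1 delta ->
  (K1 = None -> exists c, c \in C) ->
  exists g, [/\ isometric_embedding d d g, {in C, forall c, g c = c} &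
    forall a, a \in s -> {in B, forall b, canon delta d C (g a) b (d (g a) b)}].
Proof.
move=> ht hC; elim: s => [|a s [g [ig gC gs]]]; first by exists id; split.
pose E := C `|` [fset g x | x in s].
have [||p pE pB] := @one_point_indep C E B (g a) ht hC.
- exact: fsubsetUl.
- move=> x b; rewrite inE => /orP[hx _|/imfsetP[y hy ->] hb].
    by apply: canon_base hx _; left; apply: limit_dxx.
  exact: gs.
pose f x := if x == a then p else g x.
have pg x : x \in C \/ x \in s -> d p (g x) = d a x.
  move=> hx; rewrite pE ?ig //; case: hx => hx; rewrite inE.
    by rewrite gC // hx.
  by apply/orP; right; apply/imfsetP; exists x.
have hf : {in [fset x in a :: s] `|` C &, forall x y, d (f x) (f y) = d x y}.
  move=> x y; rewrite !inE /f => hx hy.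
  have [->|nx] := eqVneq x a; have [->|ny] := eqVneq y a.
  - by rewrite !limit_dxx.
  - apply: pg; move: hy; rewrite (negbTE ny) /= => /orP[]; by [right|left].
  - rewrite limit_dC (limit_dC x); apply: pg.
    move: hx; rewrite (negbTE nx) /= => /orP[]; by [right|left].
  - exact: ig.
have [h [_ ih fh]] := limit_homogeneous hf; exists h; split=> //.
  move=> c hc; rewrite -fh ?inE ?hc ?orbT // /f; case: eqP => [e|_]; last exact: gC.
  by apply: limit_d0; have := pg c (or_introl hc); rewrite gC // e limit_dxx.
move=> x hx b hb; rewrite -fh ?inE; last by rewrite inE in hx; rewrite hx.
move: hx; rewrite inE /f; case: eqP => [_ _|_ /= hx]; [exact: pB|exact: gs].
Qed.

Lemma canonical_indep_sir (dom : {fset T} -> Prop) : tame K1 delta ->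
  (forall C, dom C -> K1 = None -> exists c, c \in C) ->
  sir_axioms d dom canonical_indep.
Proof.
move=> ht hdom; have iso := same_type_isometry limit_homogeneous.
have canon_dist C C' (f : T -> T) a b : {subset C' <= f @` C} ->
    {in C, forall c, d (f a) (f c) = d a c} ->
    {in C, forall c, d (f b) (f c) = d b c} ->
    forall z, canon delta d C' (f a) (f b) z -> canon delta d C a b z.
  move=> hC ha hb z [h|[c' /hC /imfsetP[c hc ->] h]]; first by left.
  by right; exists c => //; rewrite -ha // -hb.
split.
- move=> A B C f hC /iso hf.
  have inU x : [|| x \in A, x \in B | x \in C] -> x \in A `|` B `|` C.
    by rewrite !inE orbA.
  split=> h a b.
    move=> /imfsetP[x hx ->] /imfsetP[y hy ->].
    rewrite hf; try (apply: inU; by rewrite ?hx ?hy ?orbT).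
    case: (h x y hx hy) => [|[c hc he]]; first by left.
    right; exists (f c); first by apply/imfsetP; exists c.
    by rewrite !hf //; apply: inU; rewrite ?hx ?hy ?hc ?orbT.
  move=> ha hb; rewrite -hf; try (apply: inU; by rewrite ?ha ?hb ?orbT).
  apply: (@canon_dist C (f @` C) f) => //.
  + by move=> c hc; apply: hf; apply: inU; rewrite ?ha ?hc ?orbT.
  + by move=> c hc; apply: hf; apply: inU; rewrite ?hb ?hc ?orbT.
  + by apply: h; apply/imfsetP; [exists a|exists b].
- by move=> A B C _ h b a hb ha; rewrite limit_dC; apply: canonC; apply: h.
- move=> A B C D _ h; split=> a b ha hb.
    by apply: h => //; rewrite inE hb.
  have hb' : b \in B `|` D by rewrite inE hb orbT.
  case: (h a b ha hb') => [|[c hc he]]; first by left.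
  by right; exists c => //; rewrite inE hc orbT.
- move=> A B C hC.
  have [g [ig gC gA]] := canonical_indep_ex B A ht (hdom C hC).
  exists g; first by split=> //; apply/iso => x y _ _; apply: ig.
  by move=> a b /imfsetP[x hx ->] hb; apply: gA.
- move=> A B C f hC [fC /iso fi] h1 h2.
  have fc a c : a \in A -> c \in C -> d (f a) c = d a c.
    by move=> ha hc; rewrite -{1}(fC c hc) fi // inE ?ha ?hc ?orbT.
  have fb a b : a \in A -> b \in B -> d (f a) b = d a b.
    move=> ha hb; have hfa : f a \in f @` A by apply/imfsetP; exists a.
    have bnd c : c \in C -> tri_ok K1 delta (d (f a) b) (d a c) (d b c).
      by move=> hc; rewrite -(fc a c ha hc); apply: limit_tri.
    have par : K1 = None -> odd (d (f a) b) = odd (d a b).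
      move=> K0; have [c hc] := hdom C hC K0.
      have [_ _ _ _ p1] := bnd c hc; have [_ _ _ _ p2] := limit_tri a b c.
      by rewrite K0 in p1 p2; lia.
    have odd_mid : mid delta (d (f a) b) -> mid delta (d a b) ->
        d (f a) b = d a b.
      rewrite /mid; move: ht par; case: (K1) => [k [_ he] _|ho /(_ erefl)] /=; lia.
    case: (h1 a b ha hb) (h2 (f a) b hfa hb) => [m1|[c hc e1]] [m2|[c' hc' e2]].
    + exact: odd_mid.
    + move: m1 e2; rewrite (fc a c' ha hc') /mid /edge.
      by have [i1 i2 i3 i4 _] := limit_tri a b c'; lia.
    + by move: m2 e1; rewrite /mid /edge; have [i1 i2 i3 i4 _] := bnd c hc; lia.
    + move: e2 e1; rewrite (fc a c' ha hc') /edge.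
      have [i1 i2 i3 i4 _] := bnd c hc; have [j1 j2 j3 j4 _] := limit_tri a b c'.
      by lia.
  pose g x := if x \in A then f x else x.
  have gBC : {in B `|` C, forall x, g x = x}.
    move=> x; rewrite inE /g; case: ifP => // hx /orP[hb|]; last exact: fC.
    by apply: limit_d0; rewrite fb // limit_dxx.
  have gA x : x \in A -> g x = f x by move=> hx; rewrite /g hx.
  have fBC a x : a \in A -> x \in B `|` C -> d (f a) x = d a x.
    by move=> ha; rewrite inE => /orP[hb|hc]; [apply: fb|apply: fc].
  exists g => //; split=> //; apply/iso => x y.
  rewrite [in X in X -> _]inE => /orP[hx|hx]; rewrite inE => /orP[hy|hy].
  + by rewrite !gA // fi // inE ?hx ?hy.
  + by rewrite gA // gBC // fBC.
  + by rewrite (gA y) // (gBC x) // limit_dC fBC // limit_dC.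
  + by rewrite !gBC.
Qed.

Lemma realize_over_pair c1 c2 x y : tri_ok K1 delta x y (d c1 c2) ->
  exists2 p, d p c1 = x & d p c2 = y.
Proof.
move=> h; have [h1 h2 h3 h4 _] := h.
have eqxy : c1 = c2 -> x = y by move=> e; move: h1 h2; rewrite e limit_dxx; lia.
have ok0 n : n <= delta -> tri_ok K1 delta n n 0 by move=> hn; split; lia.
pose t (u : [fset c1; c2]) := if fsval u == c1 then x else y.
have [|X _|p hp] := @one_point_extension [fset c1; c2] t.
- move=> u v; rewrite /t; have := fsvalP u; have := fsvalP v.
  rewrite !inE => /orP[]/eqP-> /orP[]/eqP->; rewrite ?eqxx ?limit_dxx.
  + by apply: ok0; lia.
  + case: eqP => [->|_]; first by rewrite limit_dxx; apply: ok0; lia.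
    by rewrite limit_dC; apply: tri_ok_swap12.
  + case: eqP => [->|_ //]; by rewrite limit_dxx; apply: ok0; lia.
  + by case: ifP => _; apply: ok0; lia.
- by rewrite cardfs2; case: (_ != _).
have m1 : c1 \in [fset c1; c2] by rewrite !inE eqxx.
have m2 : c2 \in [fset c1; c2] by rewrite !inE eqxx orbT.
exists p.
  by have := hp [` m1]; rewrite /t /= eqxx.
by have := hp [` m2]; rewrite /t /=; case: eqP => // /esym/eqxy->.
Qed.

Lemma limit_inhabited : exists x : T, True.
Proof.
have [[x hx]|X _|p _] := @one_point_extension fset0 (fun => 0).
- by [].
- by rewrite cardfs0.
- by exists p.
Qed.

Lemma realize_dist c n : n <= delta -> exists p, d p c = n.
Proof.
move=> hn; have [|p hp _] := @realize_over_pair c c n n; last by exists p.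
by rewrite limit_dxx; split; lia.
Qed.

Lemma bipartite_no_sir : K1 = None -> ~ has_sir d.
Proof.
move=> K0 [indep hind]; have d3 : 3 <= delta by case: hpar.
have [b _] := limit_inhabited.
have [b' hb'] : exists p, d p b = 1 by apply: realize_dist; lia.
have [|r [_ ir rb]] := family_extension limit_metric limit_homogeneous
  (u := fun _ : unit => b) (v := fun _ : unit => b').
  by move=> _ _; rewrite !limit_dxx.
have [|||||a' _ e] := sir_equidistant limit_metric limit_homogeneous
  (C := fset0) (a := b) (b := b) (b' := b') (r := r) hind => //.
- exact: imfset0.
- exact: rb tt.
have [_ _ _ _] := limit_tri a' b b'.
by rewrite K0 e (limit_dC b) hb'; lia.
Qed.

Lemma no_local_sir : (K1 = None -> ~~ odd delta) -> (K1 <> None -> odd delta) ->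
  ~ has_local_sir d.
Proof.
move=> he ho [indep hind]; have d3 : 3 <= delta by case: hpar.
have hk := admissible_half_bounded.
have [c1 _] := limit_inhabited.
have [c2 hc] : exists p, d p c1 = delta - 2 by apply: realize_dist; lia.
have hc' : d c1 c2 = delta - 2 by rewrite limit_dC.
have [|a ha1 ha2] := @realize_over_pair c1 c2 delta./2 delta./2.
  rewrite hc'; split; [lia|lia|lia|lia|].
  move: he ho hk; case: (K1) => [k _ h|/(_ erefl)].
    have {h} : odd delta by apply: h.
    by rewrite /half_bounded => hodd hk _; split; lia.
  by move=> ev _ _; lia.
have [|b hb1 hb2] := @realize_over_pair c1 c2 1 (delta - 1).
  by rewrite hc'; split; lia.
have [b' hb'] : exists p, d p b = delta by apply: realize_dist.
have opp x : d b' x = delta - d b x.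
  by have [h1 h2 h3 h4 _] := limit_tri b' b x; lia.
pose u (i : option bool) := if i is Some j then if j then c1 else c2 else b.
pose v (i : option bool) := if i is Some j then if j then c2 else c1 else b'.
have [|r [_ ir rb]] := family_extension limit_metric limit_homogeneous
  (u := u) (v := v).
  move=> [[]|] [[]|] /=; rewrite ?limit_dxx ?hc ?hc' //;
    rewrite ?(limit_dC _ b) ?(limit_dC _ b') ?opp ?hb1 ?hb2 //; lia.
have r1 : r c1 = c2 := rb (Some true).
have r2 : r c2 = c1 := rb (Some false).
have m1 : c1 \in [fset c1; c2] by rewrite !inE eqxx.
have m2 : c2 \in [fset c1; c2] by rewrite !inE eqxx orbT.
have [|||||a' ha' e] := sir_equidistant limit_metric limit_homogeneous
  (C := [fset c1; c2]) (a := a) (b := b) (b' := b') (r := r) hind => //.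
- by move=> e; rewrite e inE in m1.
- by rewrite imfset_fset2 r1 r2 fsetUC.
- exact: rb None.
- move=> a' ha' c; rewrite !inE => /orP[]/eqP->.
    by rewrite -{1}r2 ir !ha' // ha1 ha2.
  by rewrite -{1}r1 ir !ha' // ha1 ha2.
have e2 : d a' b' = delta - d a' b by rewrite limit_dC opp limit_dC.
have bl := limit_le a' b.
have [_ _ _ _] := limit_tri a' b c1.
rewrite hb1 (ha' c1 m1) ha1.
move: he ho; case: (K1) => [k _ h _|/(_ erefl) _ _]; last by lia.
have : odd delta by apply: h.
by lia.
Qed.

End Age.

Theorem theorem7p21 (delta : nat) (K1 : option nat) (K2 C0 C1 : nat)
    (Sc : finMetric -> Prop) (Gamma : countType)
    (d : Gamma -> Gamma -> nat)
    (hpar : antipodal_admissible delta K1 K2 C0 C1)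
    (hSc : admissible_constraints delta K1 K2 C0 C1 Sc)
    (hlim : fraisse_limit d
              (fun X => class_A delta K1 K2 C0 C1 X /\ omits Sc X)) :
  [/\ K1 <> None -> ~~ odd delta -> has_sir d,
      K1 = None -> odd delta -> ~ has_sir d /\ has_local_sir d,
      K1 <> None -> odd delta -> ~ has_local_sir d
    & K1 = None -> ~~ odd delta -> ~ has_local_sir d].
Proof.
have hk := admissible_half_bounded hpar.
split=> hK hd.
- exists (canonical_indep delta d).
  by apply: (canonical_indep_sir hpar hSc hlim) => //; case: (K1) hK hk.
- split; first exact: (bipartite_no_sir hpar hSc hlim).
  exists (canonical_indep delta d).
  apply: (canonical_indep_sir hpar hSc hlim); first by rewrite hK.
  by move=> C /eqP/fset0Pn[c hc] _; exists c.
- by apply: (no_local_sir hpar hSc hlim).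
- by apply: (no_local_sir hpar hSc hlim) => // /(_ hK).
Qed.
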